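(* There exists an absolute constant $C>0$ such that the following holds. Let $N\ge 2$, $0<\epsilon<1$, let $\Omega\subset\{1,\dots,N\}$ be an arbitrary (deterministic) set of cardinality $n<N$, and let $s\in\mathbb{N}$. Let $x\in\mathbb{R}^N$ be an $s$-sparse vector (i.e. $|\{j: x_j\neq 0\}|\le s$) with fixed support and fixed magnitudes $|x_j|$, whose signs $\operatorname{sgn}(x_j)$ on the support are independent Bernoulli $\pm1$ random variables. Let $b=(b_0,\dots,b_{N-1})\in\mathbb{R}^N$ be a random vector with independent Bernoulli $\pm1$ entries, independent of the signs of $x$, and let $y=S^b_\Omega x\in\mathbb{R}^n$. If $$ n\ge C\, s\,\log^3(N/\epsilon),$$ then with probability at least $1-\epsilon$ the solution of the $\ell_1$-minimization problem $$\min_{z\in\mathbb{R}^N}\|z\|_1\quad\text{subject to } S^b_\Omega z=y$$ coincides with $x$. The same statement holds with $T^c_\Omega$ in place of $S^b_\Omega$, where $c=(c_{-N+1},\dots,c_{N-1})\in\mathbb{R}^{2N-1}$ is a random vector with independent Bernoulli $\pm1$ entries (independent of the signs of $x$) and $y=T^c_\Omega x$.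
   Context: A Bernoulli $\pm1$ random variable takes the values $+1$ and $-1$ with probability $1/2$ each. For $b=(b_0,\dots,b_{N-1})\in\mathbb{R}^N$ the circulant matrix $S^b\in\mathbb{R}^{N\times N}$ has entries $S^b_{i,j}=b_{(j-i)\bmod N}$, $i,j=1,\dots,N$. For $c=(c_{-N+1},\dots,c_{N-1})$ the Toeplitz matrix $T^c\in\mathbb{R}^{N\times N}$ has entries $T^c_{i,j}=c_{j-i}$. For $\Omega\subset\{1,\dots,N\}$ with $|\Omega|=n$, $S^b_\Omega\in\mathbb{R}^{n\times N}$ (resp. $T^c_\Omega$) is the submatrix of $S^b$ (resp. $T^c$) consisting of the rows indexed by $\Omega$. *)

(* Defs.v *)
From HB Require Import structures.
From mathcomp Require Import all_boot all_order all_algebra.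
From mathcomp Require Import boolp reals exp Rstruct.
From Stdlib Require Import Rdefinitions.
From mathcomp Require Import zify.
Set Implicit Arguments. Unset Strict Implicit. Unset Printing Implicit Defensive.
Import Order.TTheory GRing.Theory Num.Theory.
Local Open Scope ring_scope.

Definition sgnb (t : bool) : R := if t then 1 else -1.

(* index (j - i) mod N in {0,..,N-1} (0-based rows/cols i,j) *)
Definition circ_idx N (i j : 'I_N) : 'I_N :=
  Ordinal (ltn_pmod (j + N - i)%nat (leq_ltn_trans (leq0n i) (ltn_ord i))).

Definition circulant N (b : 'I_N -> R) : 'M[R]_N :=
  \matrix_(i, j) b (circ_idx i j).

Lemma toep_idx_lt N (i j : 'I_N) : (j + N.-1 - i < 2 * N - 1)%nat.
Proof. have := ltn_ord i; have := ltn_ord j; lia. Qed.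

(* c = (c_{-N+1},...,c_{N-1}) is stored as c' : 'I_(2N-1) -> R with
   c_k = c' (k + N - 1); the entry c_{j-i} is c' (j + N - 1 - i). *)
Definition toep_idx N (i j : 'I_N) : 'I_(2 * N - 1) := Ordinal (toep_idx_lt i j).

Definition toeplitz N (c : 'I_(2 * N - 1) -> R) : 'M[R]_N :=
  \matrix_(i, j) c (toep_idx i j).

Definition l1norm N (z : 'cV[R]_N) : R := \sum_j `|z j ord0|.

(* x is the unique solution of  min ||z||_1  s.t.  A_Omega z = A_Omega x,
   where A_Omega is the row-submatrix of A with rows in Omega. *)
Definition l1_recovers N (A : 'M[R]_N) (Omega : {set 'I_N}) (x : 'cV[R]_N) : Prop :=
  forall z : 'cV[R]_N,
    (forall i, i \in Omega -> (A *m z) i ord0 = (A *m x) i ord0) ->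
    z <> x -> l1norm x < l1norm z.

Definition signed_vec N (Sx : {set 'I_N}) (a : 'I_N -> R)
  (sigma : {ffun 'I_N -> bool}) : 'cV[R]_N :=
  \col_j (if j \in Sx then sgnb (sigma j) * a j else 0).

(* Probability (uniform = independent fair Bernoulli coordinates) *)
Definition unif_prob (T : finType) (E : T -> Prop) : R :=
  (#|[set t : T | `[< E t >]]|%:R / #|T|%:R).

(* Main.v *)
(** Write the signed measurement matrix as [A], put [n = #|Omega|], and let [H_T] be the
    off-diagonal part of [A_Omega^T A_Omega / n] restricted to an index set [T].

    Moment bound.  Expanding [E tr (n H_T)^(2m)] gives a count of walks
    [j_0, i_0, j_1, i_1, ..., j_2m] in which every label [j_t - i_t], [j_(t+1) - i_t] occurs an
    even number of times.  Choose a label-preserving fixed-point-free involution of the [4m] slots;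
    there are at most [2^(4m) (4m)^(2m)] of them.  Such an involution joins the steps [t] into
    cycles, and none of them has length one because [j_t <> j_(t+1)], so there are [r <= m] cycles.
    Within a cycle one [i] determines the others, and the last increment [j_(t+1) - j_t] is
    determined by the earlier ones, whence at most [n^r |T|^(2m+1-r) <= n^m |T|^(m+1)] walks.
    With [m] of order [L = ln (N/eps)], Markov's inequality yields [|H_T|^2 <= 1/(96 L)] for all
    [T = rho |: S] simultaneously.

    Recovery.  On this event [1 + H_S] is invertible and [A_Omega^T A_S (1 + H_S)^-1 sgn / n] is a
    dual certificate as soon as its entries off [S] are less than [1] in absolute value.  The entry
    at [rho] is [<w_rho, sgn>], where [w_rho = (1 + H_S)^-1 g_rho] and [g_rho] is the column [rho]
    of [H_(rho |: S)], so [|w_rho|^2 <= 4/(96 L)] and Hoeffding's inequality for the random signs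
    concludes. *)
From Stdlib Require Import Rdefinitions.
Require Import Defs.
From mathcomp Require Import all_boot all_order all_algebra.
From mathcomp Require Import boolp reals Rstruct sequences exp.
From mathcomp Require Import zify ring lra.
Set Implicit Arguments. Unset Strict Implicit. Unset Printing Implicit Defensive.
Import Order.TTheory GRing.Theory Num.Theory.
Local Open Scope ring_scope.

(** * Fixed-point-free involutions of a finite set *)

Definition is_pairing (Z : finType) (pi : Z -> Z) :=
  [forall z, (pi (pi z) == z) && (pi z != z)].

Lemma pairingK (Z : finType) (pi : Z -> Z) : is_pairing pi -> involutive pi.
Proof. by move=> /forallP h z; have /andP[/eqP] := h z. Qed.

Lemma pairing_neq (Z : finType) (pi : Z -> Z) z : is_pairing pi -> pi z != z.
Proof. by move=> /forallP h; have /andP[] := h z. Qed.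

Definition flip_parity (k : nat) : nat := if odd k then k.-1 else k.+1.

Lemma flip_parityK : involutive flip_parity.
Proof. by move=> k; rewrite /flip_parity; case: ifP; case: ifP; lia. Qed.

Lemma flip_parity_neq k : flip_parity k != k.
Proof. by rewrite /flip_parity; case: ifP; lia. Qed.

Lemma flip_parity_lt (k n : nat) : ~~ odd n -> (k < n)%N -> (flip_parity k < n)%N.
Proof. by rewrite /flip_parity; case: ifP; lia. Qed.

(** Each fibre of [l] is listed, and the elements at positions [2i] and [2i + 1] of the list are
    matched; since the fibre is even, no partner falls past the end. *)
Lemma even_fibers_pairing (Z : finType) (K : eqType) (l : Z -> K) :
  (forall k, ~~ odd #|[pred z | l z == k]|) ->
  exists2 pi : {ffun Z -> Z}, is_pairing pi & forall z, l (pi z) = l z.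
Proof.
move=> ev; pose e z := enum [pred z' | l z' == l z].
pose pi := [ffun z => nth z (e z) (flip_parity (index z (e z)))].
have ze z : z \in e z by rewrite mem_enum inE.
have lt z : (flip_parity (index z (e z)) < size (e z))%N.
  by apply: flip_parity_lt; rewrite ?index_mem ?ze // -cardE ev.
have lpi z : l (pi z) = l z.
  apply/eqP; rewrite ffunE.
  by have := mem_nth z (lt z); rewrite mem_enum inE.
have epi z : e (pi z) = e z by rewrite /e; apply: eq_enum => x; rewrite !inE lpi.
have ipi z : index (pi z) (e z) = flip_parity (index z (e z)).
  by rewrite ffunE index_uniq ?enum_uniq.
exists pi => //; apply/forallP => z; apply/andP; split.
  rewrite {1}ffunE epi ipi flip_parityK; apply/eqP.
  by rewrite (set_nth_default z) ?nth_index ?index_mem.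
by apply/eqP => h; have := flip_parity_neq (index z (e z)); rewrite -ipi h eqxx.
Qed.

(** A pairing is recovered from the set [A pi] of elements enumerated before their partner, together
    with the list of the partners of these [k] elements: at most [2 ^ (2 * k)] sets and
    [(2 * k) ^ k] lists. *)
Lemma card_pairings (Z : finType) (k : nat) : #|Z| = (2 * k)%N ->
  (#|[set pi : {ffun Z -> Z} | is_pairing pi]| <= 2 ^ (2 * k) * (2 * k) ^ k)%N.
Proof.
move=> cZ.
pose A (pi : {ffun Z -> Z}) := [set z | (enum_rank z < enum_rank (pi z))%N].
have AC (pi : {ffun Z -> Z}) z : is_pairing pi -> z \notin A pi -> pi z \in A pi.
  move=> hp; rewrite !inE (pairingK hp) -leqNgt leq_eqVlt => /orP[|//].
  by move=> /eqP/val_inj/enum_rank_inj h; have := pairing_neq z hp; rewrite h eqxx.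
have cA (pi : {ffun Z -> Z}) : is_pairing pi -> #|A pi| = k.
  move=> hp; have : #|pi @: A pi| = #|~: A pi|.
    apply: eq_card => z; rewrite inE; apply/imsetP/idP => [[x xA ->]|zA].
      by move: xA; rewrite !inE (pairingK hp) -leqNgt => /ltnW.
    by exists (pi z); rewrite ?(pairingK hp) // AC.
  rewrite card_imset; last exact: inv_inj (pairingK hp).
  have := cardsC (A pi); lia.
have [->|[pi0]] := set_0Vmem [set pi : {ffun Z -> Z} | is_pairing pi].
  by rewrite cards0.
rewrite inE => hp0.
(* [z0] is the default of [nth]. If [Z] is empty, then [k = 0] and both sides are at most [1]. *)
have [z0|Z0] := pickP (fun _ : Z => true); last first.
  have k0 : (k = 0)%N by have := eq_card0 Z0; rewrite cZ; lia.
  rewrite k0 (leq_trans (max_card _)) // card_ffun.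
  by rewrite cZ k0.
move=> _.
pose enc (pi : {ffun Z -> Z}) : {set Z} * {ffun 'I_k -> Z} :=
  (A pi, [ffun i : 'I_k => pi (nth z0 (enum (A pi)) i)]).
have inj : {in [set pi : {ffun Z -> Z} | is_pairing pi] &, injective enc}.
  move=> p q; rewrite !inE => hp hq [eA /ffunP eg].
  have on z : z \in A p -> p z = q z.
    move=> zA; have lt : (index z (enum (A p)) < k)%N.
      by rewrite -(cA _ hp) cardE index_mem mem_enum.
    have := eg (Ordinal lt); rewrite !ffunE /= -eA.
    by rewrite nth_index // mem_enum.
  apply/ffunP => z; have [/on //|zA] := boolP (z \in A p).
  have := AC _ _ hp zA => /on; rewrite (pairingK hp) => h.
  by rewrite {2}h (pairingK hq).
rewrite -(card_in_imset inj) (leq_trans (max_card _)) //.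
rewrite card_prod card_ffun card_ord cZ leq_mul // -cZ.
by rewrite -[X in (X <= _)%N]cardsT -powersetT card_powerset cardsT.
Qed.

(** * Walks whose slots are matched by a pairing *)

(** The word [sg (pi sg)^k] is a palindrome of odd length, hence a conjugate of [pi] or [sg], and so
    it fixes no point. The induction strips two letters from each end. *)
Lemma pairing_orbits_disjoint (Z : finType) (pi sg : Z -> Z) (z : Z) (k : nat) :
  is_pairing pi -> is_pairing sg -> iter k (pi \o sg) z <> sg z.
Proof.
move=> hp hs; elim/ltn_ind: k z => -[|[|k]] IH z /=.
- by move=> h; have := pairing_neq z hs; rewrite -h eqxx.
- by move=> h; have := pairing_neq (sg z) hp; rewrite h eqxx.
move=> h; apply: (IH k _ (pi (sg z))) => //.
move/(congr1 pi): h; rewrite (pairingK hp) => /(congr1 sg); rewrite (pairingK hs).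
by move=> h; apply: etrans h; rewrite -(iterSr k (pi \o sg) z).
Qed.

(* The slots [(t, false)] and [(t, true)] carry the labels of [(i_t, j_t)] and
   [(i_t, j_(t+1))]; [slot_pos] is the index of the [j] involved. *)
Definition slot_pos k (z : 'I_k * bool) : 'I_k.+1 :=
  if z.2 then lift ord0 z.1 else widen_ord (leqnSn k) z.1.

Definition slot_swap k (z : 'I_k * bool) : 'I_k * bool := (z.1, ~~ z.2).

Lemma slot_swap_pairing k : is_pairing (@slot_swap k).
Proof.
apply/forallP => -[t e]; rewrite /slot_swap /= negbK eqxx /= xpair_eqE eqxx /=.
by case: e.
Qed.

Definition step_rel k (pi : 'I_k * bool -> 'I_k * bool) : rel 'I_k :=
  fun t u => [exists e, exists e', pi (t, e) == (u, e')].

(** One representative for each component of [step_rel]. Choosing the last step makes the position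
    reached after it depend on earlier positions only. *)
Definition comp_max k (pi : 'I_k * bool -> 'I_k * bool) : {set 'I_k} :=
  [set t | [forall u : 'I_k, connect (step_rel pi) t u ==> (u <= t)%N]].

Lemma step_relP k (pi : 'I_k * bool -> 'I_k * bool) z : step_rel pi z.1 (pi z).1.
Proof.
apply/existsP; exists z.2; apply/existsP; exists (pi z).2.
by rewrite -!surjective_pairing.
Qed.

Lemma step_rel_sym k (pi : 'I_k * bool -> 'I_k * bool) :
  is_pairing pi -> connect_sym (step_rel pi).
Proof.
move=> hp; apply: sym_connect_sym => t u.
apply/existsP/existsP => -[e /existsP[e' /eqP h]]; exists e'; apply/existsP; exists e;
by rewrite -h (pairingK hp).
Qed.

Lemma comp_max_uniq k (pi : 'I_k * bool -> 'I_k * bool) t u : is_pairing pi ->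
  t \in comp_max pi -> u \in comp_max pi -> connect (step_rel pi) t u -> t = u.
Proof.
move=> hp; rewrite !inE => /forallP/(_ u)/implyP h1 /forallP/(_ t)/implyP h2 c.
apply/val_inj/eqP; rewrite eqn_leq h1 ?h2 //.
by rewrite step_rel_sym.
Qed.

Lemma comp_max_ex k (pi : 'I_k * bool -> 'I_k * bool) t :
  exists2 u, u \in comp_max pi & connect (step_rel pi) t u.
Proof.
have [u cu hu] := arg_maxnP (fun u : 'I_k => nat_of_ord u) (connect0 (step_rel pi) t).
exists u => //; rewrite inE; apply/forallP => v; apply/implyP => c.
exact/hu/(connect_trans cu).
Qed.

(** Following the slot [(t, false)] leads from a representative to a different step of the same
    component, which is therefore not a representative. So each component has at least two steps. *)
Lemma card_comp_max k (pi : 'I_k * bool -> 'I_k * bool) : is_pairing pi ->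
  (forall z, (pi z).1 != z.1) -> (2 * #|comp_max pi| <= k)%N.
Proof.
move=> hp h; pose p t := (pi (t, false)).1.
have ct t : connect (step_rel pi) t (p t) by apply/connect1/(step_relP pi (t, false)).
have inj : {in comp_max pi &, injective p}.
  move=> t u ht hu e; apply: (comp_max_uniq hp) => //.
  by apply: connect_trans (ct t) _; rewrite step_rel_sym // e ct.
have : (#|p @: comp_max pi| <= #|~: comp_max pi|)%N.
  apply/subset_leq_card/subsetP => _ /imsetP[t ht ->]; rewrite inE.
  apply/negP => hpt; have := h (t, false).
  by rewrite -/(p t) -(comp_max_uniq hp ht hpt (ct t)) eqxx.
rewrite card_in_imset //.
have := cardsC (comp_max pi); rewrite card_ord; move: #|_| #|_| => x y; lia.
Qed.

(* [dj] and [di] are the differences of two walks compatible with [pi].  The function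
   [f z = dj (slot_pos z) - di z.1] is [pi]-invariant, so [f (slot_swap z) - f z] sums to zero over
   an orbit of [pi \o slot_swap].  For the orbit of [(u, true)] with [u] the last step of its
   component, all terms but [dj (u + 1)] vanish by induction, as the orbit avoids [(u, false)]. *)
Lemma walk_rigid (V : zmodType) k (pi : 'I_k * bool -> 'I_k * bool)
    (dj : 'I_k.+1 -> V) (di : 'I_k -> V) : is_pairing pi ->
  (forall z, dj (slot_pos (pi z)) - di (pi z).1 = dj (slot_pos z) - di z.1) ->
  dj ord0 = 0 -> (forall t, t \notin comp_max pi -> dj (lift ord0 t) = 0) ->
  (forall t, t \in comp_max pi -> di t = 0) ->
  (forall t, dj t = 0) /\ (forall t, di t = 0).
Proof.
move=> hp hf hj0 hj hi; pose f z := dj (slot_pos z) - di z.1.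
pose tau z := pi (slot_swap z).
have tau_inj : injective tau.
  by apply: inj_comp; apply: inv_inj; apply: pairingK => //; apply: slot_swap_pairing.
have dj0 t : dj t = 0.
  have [n] := ubnP (val t); elim: n t => // n IH t; rewrite ltnS => tn.
  have [->//|/negbTE t0] := eqVneq t ord0.
  have [u tu] : exists u : 'I_k, t = lift ord0 u.
    by case: (unliftP ord0 t) => [u ->|e]; [exists u | rewrite e eqxx in t0].
  rewrite tu; have [uR|/hj//] := boolP (u \in comp_max pi).
  pose z0 := (u, true); pose O := [pred z | fconnect tau z0 z].
  have cO z : z \in O -> (z.1 <= u)%N.
    move=> /iter_findex <-; move: (findex _ _ _) => m.
    move: uR; rewrite inE => /forallP/(_ (iter m tau z0).1)/implyP; apply.
    elim: m => [|m IHm]; first exact: connect0.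
    by apply: connect_trans IHm _; apply/connect1; rewrite iterS; apply: step_relP (slot_swap _).
  have swO : slot_swap z0 \notin O.
    apply/negP => /iter_findex h.
    exact: (pairing_orbits_disjoint (z := z0) hp (slot_swap_pairing k) h).
  have z0O : z0 \in O by apply: connect0.
  have dj_lt z : z \in O -> z != z0 -> dj (slot_pos z) = 0.
    move=> zO; have := cO _ zO; case: z zO => v [] /= zO vu zz0; apply: IH => /=; last first.
      by move: tn; rewrite tu /= /bump /=; lia.
    move: tn; rewrite tu /= /bump /= !add1n => tn.
    suff : nat_of_ord v != u by lia.
    by apply: contraNneq zz0 => /val_inj ->.
  have djs_lt z : z \in O -> dj (slot_pos (slot_swap z)) = 0.
    move=> zO; have := cO _ zO; case: z zO => v [] /= zO vu; apply: IH => /=.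
      by move: tn; rewrite tu /= /bump /=; lia.
    move: tn; rewrite tu /= /bump /= !add1n => tn.
    suff : nat_of_ord v != u by lia.
    by apply: contraNneq swO => /val_inj vu'; rewrite /z0 -vu'.
  have : \sum_(z in O) (f (tau z) - f z) = 0.
    rewrite sumrB; apply/eqP; rewrite subr_eq0; apply/eqP.
    rewrite [RHS](reindex_inj tau_inj) /=; apply: eq_bigl => z.
    by rewrite !inE (same_connect_r (fconnect_sym tau_inj) (fconnect1 tau z)).
  rewrite (bigD1 z0) //= big1 => [|z /andP[zO zz0]].
    rewrite addr0 /f hf opprB addrA subrK djs_lt // sub0r => /eqP.
    by rewrite oppr_eq0 => /eqP.
  by rewrite /f hf opprB addrA subrK djs_lt // dj_lt // subr0.
split=> // t; have [u uR] := comp_max_ex pi t.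
(* With [dj = 0], invariance under [pi] says that [di] is constant along [step_rel], so its value
   [0] at the representative spreads over the component. *)
move=> /connectP[p]; elim: p t => [|v p IH] t /=; first by move=> _ <-; apply: hi.
move=> /andP[/existsP[e /existsP[e' /eqP etv]] pv lv].
have := hf (t, e); rewrite etv !dj0 !sub0r => /oppr_inj /= <-.
exact: IH.
Qed.

Definition paired_walks (J : finType) (V : zmodType) (iota : J -> V) (Om T : {set J})
    k (pi : 'I_k * bool -> 'I_k * bool) : {set {ffun 'I_k -> J} * {ffun 'I_k.+1 -> J}} :=
  [set w : {ffun 'I_k -> J} * {ffun 'I_k.+1 -> J} |
   [&& [forall t, w.1 t \in Om], [forall t, w.2 t \in T],
     [forall t, w.2 (slot_pos (t, false)) != w.2 (slot_pos (t, true))] &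
     [forall z, iota (w.2 (slot_pos (pi z))) - iota (w.1 (pi z).1)
                == iota (w.2 (slot_pos z)) - iota (w.1 z.1)]]].

(** Record [i] at the [r] representatives, and [j] at all positions except those right after a
    representative. By [walk_rigid], applied to the difference of two walks, this code is injective.
    It takes at most [|Om|^r |T|^(2m+1-r)] values, and since [r <= m] the [m - r] surplus factors
    [|T|] can be replaced by [|Om|]. *)
Lemma card_paired_walks (J : finType) (V : zmodType) (iota : J -> V) (Om T : {set J})
    m (pi : 'I_(2 * m) * bool -> 'I_(2 * m) * bool) :
  injective iota -> is_pairing pi -> (#|T| <= #|Om|)%N ->
  (#|paired_walks iota Om T pi| <= #|T| ^ m.+1 * #|Om| ^ m)%N.
Proof.
move=> iinj hp TO; set W := paired_walks _ _ _ _.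
have [->|[w0 w0W]] := set_0Vmem W; first by rewrite cards0.
have WP w : w \in W -> [/\ forall t, w.1 t \in Om, forall t, w.2 t \in T,
    forall t, w.2 (slot_pos (t, false)) != w.2 (slot_pos (t, true)) &
    forall z, iota (w.2 (slot_pos (pi z))) - iota (w.1 (pi z).1)
                = iota (w.2 (slot_pos z)) - iota (w.1 z.1)].
  by rewrite inE => /and4P[/forallP ? /forallP ? /forallP ? /forallP h]; split=> // z; apply/eqP.
(* If [pi] matched the two slots of one step, the common [i] would cancel and [iinj] would give
   [j_t = j_(t+1)]. *)
have pi1 z : (pi z).1 != z.1.
  have [_ _ ne /(_ z)] := WP _ w0W.
  have := pairing_neq z hp; move: (pi z) => -[u e]; case: z => t e' /= ute; apply: contra_eqN.
  move=> /eqP ut; rewrite ut (inj_eq (addIr _)) (inj_eq iinj).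
  move: ute; rewrite ut xpair_eqE eqxx /=; have := ne t.
  by case: e; case: e' => //; rewrite eq_sym.
have := card_comp_max hp pi1; set Rm := comp_max pi => cR.
(* [x0] is the filler at positions that are not recorded, which turns the codes into elements of
   [pffun_on]. Position [0] always lies in [D]. *)
pose x0 := w0.2 ord0; pose D := ~: (lift ord0 @: Rm).
have cD : #|D| = ((2 * m).+1 - #|Rm|)%N.
  rewrite cardsCs setCK card_ord card_imset //; exact: lift_inj.
pose enc (w : {ffun 'I_(2 * m) -> J} * {ffun 'I_(2 * m).+1 -> J}) :=
  ([ffun t => if t \in Rm then w.1 t else x0], [ffun p => if p \in D then w.2 p else x0]).
have inj : {in W &, injective enc}.
  move=> [i j] [i' j'] /WP[_ _ _ /= h] /WP[_ _ _ /= h'] [/ffunP ei /ffunP ej].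
  have [||||hj hi] := walk_rigid (dj := fun p => iota (j p) - iota (j' p))
      (di := fun t => iota (i t) - iota (i' t)) hp.
  - move=> z; have ac (a b c d : V) : a - b - (c - d) = (a - c) - (b - d).
      by rewrite !opprD !opprK addrACA.
    by rewrite ac h h' ac.
  - have D0 : ord0 \in D.
      by rewrite inE; apply/imsetP => -[u _ /eqP]; rewrite (negbTE (neq_lift _ _)).
    by have := ej ord0; rewrite !ffunE D0 => ->; exact: subrr.
  - move=> t tR; have Dt : lift ord0 t \in D by rewrite inE mem_imset //; apply: lift_inj.
    by have := ej (lift ord0 t); rewrite !ffunE Dt => ->; exact: subrr.
  - by move=> t tR; have := ei t; rewrite !ffunE tR => ->; exact: subrr.
  congr pair; apply/ffunP => t; apply/iinj/eqP; rewrite -subr_eq0.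
    by rewrite hi.
  by rewrite hj.
pose B := setX [set f in pffun_on x0 (mem Rm) (mem Om)] [set f in pffun_on x0 (mem D) (mem T)].
have sub : enc @: W \subset B.
  apply/subsetP => _ /imsetP[w /WP[wO wT _ _] ->]; rewrite !inE /=.
  apply/andP; split; apply/pffun_onP; split.
  - by apply/subsetP => t; rewrite unfold_in /= ffunE; case: ifP; rewrite ?eqxx.
  - by move=> _ /imageP[t tR ->]; rewrite ffunE tR; apply: wO.
  - by apply/subsetP => t; rewrite unfold_in /= ffunE; case: ifP; rewrite ?eqxx.
  - by move=> _ /imageP[t tD ->]; rewrite ffunE tD; apply: wT.
rewrite -(card_in_imset inj) (leq_trans (subset_leq_card sub)) //.
rewrite cardsX !cardsE !card_pffun_on cD.
have -> : ((2 * m).+1 - #|Rm| = (m - #|Rm|) + m.+1)%N by move: #|_| cR => r; lia.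
rewrite expnD mulnA mulnC leq_mul //.
have Rm_le : (#|Rm| <= m)%N by move: #|_| cR => r; lia.
rewrite -[X in (_ <= _ ^ X)%N](subnKC Rm_le) expnD leq_mul //.
by case: (m - _)%N => // d; rewrite leq_exp2r.
Qed.

(** * Trace moments of the random Gram matrix as counts of walks *)

Lemma expmx_walks (F : pzRingType) N (M : 'M[F]_N) k a c :
  (M ^+ k) a c = \sum_(j : {ffun 'I_k.+1 -> 'I_N} | (j ord0 == a) && (j ord_max == c))
    \prod_(t < k) M (j (slot_pos (t, false))) (j (slot_pos (t, true))).
Proof.
elim: k a c => [|k IH] a c.
  rewrite expr0 mxE; under eq_bigr do rewrite big_ord0.
  have [->|ac] := eqVneq a c.
    rewrite (big_pred1 [ffun=> c]) // => j /=.
    apply/andP/eqP => [[/eqP j0 _]|->]; last by rewrite !ffunE eqxx.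
    by apply/ffunP => t; rewrite ffunE ord1.
  rewrite big_pred0 // => j; apply/negP => /andP[/eqP ja /eqP jc].
  by move: ac; rewrite -ja -jc (_ : ord_max = ord0) ?eqxx //; apply/val_inj.
rewrite exprS mxE; under eq_bigr do rewrite IH big_distrr /=.
pose fcons (j : {ffun 'I_k.+1 -> 'I_N}) : {ffun 'I_k.+2 -> 'I_N} :=
  [ffun t => if unlift ord0 t is Some u then j u else a].
pose ftl (j : {ffun 'I_k.+2 -> 'I_N}) := [ffun u => j (lift ord0 u)].
have fc0 j : fcons j ord0 = a by rewrite ffunE unlift_none.
have fcS j u : fcons j (lift ord0 u) = j u by rewrite ffunE liftK.
rewrite [RHS](reindex_onto fcons ftl) /=; last first.
  move=> j /andP[/eqP j0 _]; apply/ffunP => t.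
  case: (unliftP ord0 t) => [u ->|->]; rewrite ?fcS ?fc0 ?ffunE //.
rewrite [RHS](eq_bigl (fun j : {ffun 'I_k.+1 -> 'I_N} => j ord_max == c)); last first.
  move=> j; rewrite fc0 eqxx /=.
  have -> : ord_max = lift ord0 ord_max :> 'I_k.+2 by apply/val_inj.
  rewrite fcS; have -> : ftl (fcons j) = j by apply/ffunP => u; rewrite ffunE fcS.
  by rewrite eqxx andbT.
rewrite [RHS](partition_big (fun j : {ffun 'I_k.+1 -> 'I_N} => j ord0) xpredT) //=.
apply: eq_bigr => b _; apply: eq_big => [j|j /andP[/eqP jb _]]; first by rewrite andbC.
rewrite [RHS]big_ord_recl; congr (_ * _).
  have -> : slot_pos (ord0 : 'I_k.+1, false) = ord0 by apply/val_inj.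
  have -> : slot_pos (ord0 : 'I_k.+1, true) = lift ord0 ord0 by apply/val_inj.
  by rewrite fc0 fcS jb.
apply: eq_bigr => t _.
have pS e : slot_pos (lift ord0 t, e) = lift ord0 (slot_pos (t, e)).
  by apply/val_inj; case: e.
by rewrite !pS !fcS.
Qed.

Lemma sgnbN e : sgnb (~~ e) = - sgnb e.
Proof. by case: e; rewrite /sgnb //= opprK. Qed.

Lemma sgnb_sqr e : sgnb e * sgnb e = 1.
Proof. by case: e; rewrite /sgnb ?mulr1 // mulrNN mulr1. Qed.

Lemma prod_sgnb_fibers (Z K : finType) (l : Z -> K) (b : K -> bool) :
  \prod_z sgnb (b (l z)) = \prod_(x : K) sgnb (b x) ^+ #|[pred z | l z == x]|.
Proof.
rewrite (partition_big l xpredT) //=; apply: eq_bigr => x _.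
by rewrite (eq_bigr (fun=> sgnb (b x))) ?prodr_const // => z /eqP ->.
Qed.

(** If some label [x] has odd multiplicity, flipping the sign [b x] negates the product, and the sum
    cancels. Otherwise every product is [1]. *)
Lemma sum_prod_sgnb (Z K : finType) (l : Z -> K) :
  \sum_(b : {ffun K -> bool}) \prod_z sgnb (b (l z)) =
  if [forall x : K, ~~ odd #|[pred z | l z == x]|] then (2 ^ #|K|)%:R else 0.
Proof.
case: ifP => [/forallP ev|/negbT/forallPn[x]].
  rewrite (eq_bigr (fun=> 1)) => [|b _].
    by rewrite sumr_const card_ffun card_bool.
  rewrite prod_sgnb_fibers big1 // => x _.
  by rewrite -[#|_|]odd_double_half (negbTE (ev x)) add0n -mul2n exprM expr2 sgnb_sqr expr1n.
rewrite negbK => ox; set s := \sum_b _.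
pose fl (b : {ffun K -> bool}) : {ffun K -> bool} := [ffun y => (y == x) (+) b y].
have flK : involutive fl.
  by move=> b; apply/ffunP => y; rewrite !ffunE addbA addbb addFb.
have sN : s = - s.
  rewrite {1}/s (reindex_inj (inv_inj flK)) /= -sumrN; apply: eq_bigr => b _.
  rewrite !prod_sgnb_fibers (bigD1 x) //= [in RHS](bigD1 x) //= -mulNr; congr (_ * _).
    by rewrite ffunE eqxx addTb sgnbN exprNn -signr_odd ox expr1 mulN1r.
  by apply: eq_bigr => y /negbTE yx; rewrite ffunE yx.
by apply/eqP; have := sN => /eqP; rewrite -addr_eq0 -mulr2n mulrn_eq0.
Qed.

(** This is [n H_T], padded with zeros to size [N] so that all index sets [T] share one matrix
    type. *)
Definition offgram N (Om T : {set 'I_N}) (A : 'M[R]_N) : 'M[R]_N :=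
  \matrix_(j, l) if [&& j \in T, l \in T & j != l] then \sum_(i in Om) A i j * A i l else 0.

Lemma prod_offgram N (Om T : {set 'I_N}) (A : 'M[R]_N) k (j j' : {ffun 'I_k -> 'I_N}) :
  \prod_(t < k) offgram Om T A (j t) (j' t) =
  if [forall t, [&& j t \in T, j' t \in T & j t != j' t]] then
    \sum_(i : {ffun 'I_k -> 'I_N} | [forall t, i t \in Om])
      \prod_(t < k) (A (i t) (j t) * A (i t) (j' t)) else 0.
Proof.
case: ifP => [/forallP h|/negbT/forallPn[t /negbTE h]]; last first.
  by apply/eqP/prodf_eq0; exists t => //; rewrite mxE h.
rewrite (eq_bigr (fun t => \sum_(i in Om) A i (j t) * A i (j' t))).
  by rewrite bigA_distr_big; apply: eq_bigl => i; apply/ffun_onP/forallP.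
by move=> t _; rewrite mxE h.
Qed.

(** [phi i j] names the random sign sitting at entry [(i, j)]; circulant and Toeplitz matrices
    differ only in [phi]. *)
Definition sgnmx N (K : finType) (phi : 'I_N -> 'I_N -> K) (b : K -> bool) : 'M[R]_N :=
  \matrix_(i, j) sgnb (b (phi i j)).

(** All that is asked of the matrix structure is that a label determines the difference [j - i] in
    some group [V]. Averaging over the signs leaves the walks with even label multiplicities, and
    these are counted once for every compatible pairing. *)
Lemma sum_trace_offgram N (K : finType) (V : zmodType) (iota : 'I_N -> V)
    (phi : 'I_N -> 'I_N -> K) (Om T : {set 'I_N}) m :
  injective iota ->
  (forall i j i' j', phi i j = phi i' j' -> iota j - iota i = iota j' - iota i') ->
  (0 < m)%N -> (#|T| <= #|Om|)%N ->
  \sum_(b : {ffun K -> bool}) \tr (offgram Om T (sgnmx phi b) ^+ (2 * m)) <=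
  (2 ^ #|K| * ((2 ^ (4 * m) * (4 * m) ^ (2 * m)) * (#|T| ^ m.+1 * #|Om| ^ m)))%:R.
Proof.
move=> iinj hphi m0 TO; set k := (2 * m)%N.
pose val_j (j : {ffun 'I_k.+1 -> 'I_N}) := [forall t,
  [&& j (slot_pos (t, false)) \in T, j (slot_pos (t, true)) \in T
    & j (slot_pos (t, false)) != j (slot_pos (t, true))]].
pose val_i (i : {ffun 'I_k -> 'I_N}) := [forall t, i t \in Om].
pose lab (i : {ffun 'I_k -> 'I_N}) (j : {ffun 'I_k.+1 -> 'I_N}) (z : 'I_k * bool) :=
  phi (i z.1) (j (slot_pos z)).
have trE (b : {ffun K -> bool}) : \tr (offgram Om T (sgnmx phi b) ^+ k) =
   \sum_(j : {ffun 'I_k.+1 -> 'I_N} | (j ord0 == j ord_max) && val_j j)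
     \sum_(i | val_i i) \prod_z sgnb (b (lab i j z)).
  rewrite /mxtrace; under eq_bigr do rewrite expmx_walks.
  rewrite big_mkcondr /= [RHS](partition_big (fun j : {ffun 'I_k.+1 -> 'I_N} => j ord0) xpredT) //=.
  apply: eq_bigr => a _; apply: eq_big => [j|j _].
    by rewrite andbC; have [->|] := eqVneq (j ord0) a; rewrite ?andbF // eq_sym.
  pose j1 := [ffun t : 'I_k => j (slot_pos (t, false))].
  pose j2 := [ffun t : 'I_k => j (slot_pos (t, true))].
  rewrite (eq_bigr (fun t => offgram Om T (sgnmx phi b) (j1 t) (j2 t))); last first.
    by move=> t _; rewrite !ffunE.
  rewrite prod_offgram.
  rewrite (eq_forallb (P2 := fun t =>
    [&& j (slot_pos (t, false)) \in T, j (slot_pos (t, true)) \in T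
    & j (slot_pos (t, false)) != j (slot_pos (t, true))])); last by move=> t; rewrite !ffunE.
  rewrite -/(val_j j); case: ifP => // _; apply: eq_bigr => i _.
  rewrite (eq_bigr (fun t => \prod_e sgnb (b (lab i j (t, e))))).
    by rewrite pair_big /=; apply: eq_bigr => -[].
  by move=> t _; rewrite big_bool !ffunE !mxE mulrC.
under eq_bigr do rewrite trE.
rewrite exchange_big /=; under eq_bigr do rewrite exchange_big /=.
under eq_bigr do under eq_bigr do rewrite sum_prod_sgnb.
pose Pr := [set pi : {ffun 'I_k * bool -> 'I_k * bool} | is_pairing pi].
(* A surviving walk has at least one compatible pairing, so its indicator is at most the number of
   such pairings. The condition that the walk is closed is dropped here. *)
apply: (@le_trans _ _ (\sum_(j : {ffun 'I_k.+1 -> 'I_N}) \sum_(i : {ffun 'I_k -> 'I_N})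
   (2 ^ #|K|)%:R * \sum_(pi in Pr) ((i, j) \in paired_walks iota Om T pi)%:R)).
  rewrite big_mkcond /=; apply: ler_sum => j _; rewrite big_mkcond /=.
  have pos (i : {ffun 'I_k -> 'I_N}) :
      0 <= (2 ^ #|K|)%:R * \sum_(pi in Pr) ((i, j) \in paired_walks iota Om T pi)%:R :> R.
    by rewrite mulr_ge0 ?sumr_ge0.
  case: ifP => [/andP[_ /forallP vj]|_]; last by rewrite sumr_ge0.
  apply: ler_sum => i _; case: ifP => // vi; case: ifP => // /forallP ev.
  have [pi hp hl] := even_fibers_pairing ev.
  rewrite -[X in X <= _]mulr1 ler_wpM2l // (bigD1 pi) /=; last by rewrite inE.
  suff -> : (i, j) \in paired_walks iota Om T pi by rewrite lerDl sumr_ge0.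
  rewrite inE; apply/and4P; split=> //; apply/forallP => /=.
  - move=> t; case: (unliftP ord0 t) => [u ->|->].
      by have /and3P[_] := vj u.
    (* Position [0] ends no step; its membership in [T] is read off the start of step [0], which
       exists because [0 < m]. *)
    have k0 : (0 < k)%N by rewrite /k; lia.
    have /and3P[+ _ _] := vj (Ordinal k0).
    by rewrite (_ : slot_pos _ = ord0) //; apply/val_inj.
  - by move=> t; have /and3P[] := vj t.
  - by move=> z; apply/eqP/hphi/hl.
rewrite exchange_big pair_bigA /= -big_distrr /= natrM ler_wpM2l // exchange_big /=.
have walks_le pi : pi \in Pr ->
    \sum_(w : {ffun 'I_k -> 'I_N} * {ffun 'I_k.+1 -> 'I_N})
      ((w.1, w.2) \in paired_walks iota Om T pi)%:R
    <= (#|T| ^ m.+1 * #|Om| ^ m)%:R :> R.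
  rewrite inE => hp; rewrite -natr_sum ler_nat.
  rewrite (eq_bigr (fun w => if w \in paired_walks iota Om T pi then 1 else 0)%N); last first.
    by move=> [i j] _ /=; case: ifP.
  by rewrite -big_mkcond sum1_card card_paired_walks.
apply: le_trans (ler_sum _ walks_le) _.
rewrite sumr_const -mulrnA ler_nat mulnC leq_mul //.
have kk : (4 * m = 2 * k)%N by rewrite /k; lia.
by rewrite kk card_pairings // card_prod card_ord card_bool mulnC.
Qed.

(** * Operator norm bounds from traces of powers *)

(** Lagrange's identity: the double sum of the squares [(a i * b j - a j * b i) ^+ 2] is twice the
    difference of the two sides. *)
Lemma sum_cauchy_schwarz (F : realFieldType) (I : finType) (a b : I -> F) :
  (\sum_i a i * b i) ^+ 2 <= (\sum_i a i ^+ 2) * (\sum_i b i ^+ 2).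
Proof.
have : 0 <= \sum_i \sum_j (a i * b j - a j * b i) ^+ 2.
  by do 2! apply: sumr_ge0 => ? _; apply: sqr_ge0.
have -> : \sum_i \sum_j (a i * b j - a j * b i) ^+ 2 =
    \sum_i \sum_j (a i ^+ 2 * b j ^+ 2) + \sum_i \sum_j (a j ^+ 2 * b i ^+ 2)
    - (\sum_i \sum_j (a i * b i) * (a j * b j)) *+ 2.
  rewrite mulr2n opprD -!sumrN -!big_split; apply: eq_bigr => i _ /=.
  rewrite -!sumrN -!big_split; apply: eq_bigr => j _ /=; ring.
rewrite [X in _ + X - _]exchange_big /= -!big_distrlr /= -expr2; lra.
Qed.

Definition sqn (F : realFieldType) n (u : 'cV[F]_n) : F := \sum_j u j ord0 ^+ 2.

Lemma sqn_ge0 (F : realFieldType) n (u : 'cV[F]_n) : 0 <= sqn u.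
Proof. by apply: sumr_ge0 => ? _; apply: sqr_ge0. Qed.

Lemma sqn_eq0 (F : realFieldType) n (u : 'cV[F]_n) : sqn u = 0 -> u = 0.
Proof.
move=> /psumr_eq0P h; apply/matrixP => j k; rewrite ord1 mxE; apply/eqP.
by rewrite -sqrf_eq0 h // => i _; apply: sqr_ge0.
Qed.

Lemma trmx_exp (F : comPzRingType) n (M : 'M[F]_n) k : (M ^+ k)^T = M^T ^+ k.
Proof.
by elim: k => [|k IH]; rewrite ?trmx1 // exprS exprSr -!mulmxE trmx_mul IH.
Qed.

(** By symmetry [<M u, M u> = <u, M (M u)>]; then Cauchy-Schwarz. *)
Lemma sqn_mulmx_sym (F : realFieldType) n (M : 'M[F]_n) u : M^T = M ->
  sqn (M *m u) ^+ 2 <= sqn u * sqn (M *m (M *m u)).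
Proof.
move=> sM; have -> : sqn (M *m u) = \sum_j u j ord0 * (M *m (M *m u)) j ord0.
  have e (x y : 'cV[F]_n) : \sum_j x j ord0 * y j ord0 = (x^T *m y) ord0 ord0.
    by rewrite mxE; apply: eq_bigr => j _; rewrite mxE.
  rewrite /sqn (eq_bigr (fun j => (M *m u) j ord0 * (M *m u) j ord0)) => [|j _]; last exact: expr2.
  by rewrite !e trmx_mul sM !mulmxA.
exact: sum_cauchy_schwarz.
Qed.

Lemma sqn_mulmx_frob (F : realFieldType) n (M : 'M[F]_n) u :
  sqn (M *m u) <= (\sum_j \sum_l M j l ^+ 2) * sqn u.
Proof.
rewrite big_distrl /=; apply: ler_sum => j _.
rewrite mxE; exact: sum_cauchy_schwarz.
Qed.

(* Iterates [|M u|^2 <= |u| |M^2 u|], which replaces the spectral theorem. *)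
Lemma sqn_mulmx_power (F : realFieldType) n (M : 'M[F]_n) u p : M^T = M ->
  sqn (M *m u) ^+ (2 ^ p) <= sqn (M ^+ (2 ^ p) *m u) * sqn u ^+ (2 ^ p).-1.
Proof.
move=> sM; elim: p => [|p IH]; first by rewrite expr0 mulr1 !expr1.
set q := (2 ^ p)%N in IH *; have q0 : (0 < q)%N by rewrite expn_gt0.
have -> : (2 ^ p.+1 = q * 2)%N by rewrite expnSr.
have sMq : (M ^+ q)^T = M ^+ q by rewrite trmx_exp sM.
rewrite !exprM; apply: (@le_trans _ _ ((sqn (M ^+ q *m u) * sqn u ^+ q.-1) ^+ 2)).
  by rewrite ler_pXn2r ?nnegrE // ?mulr_ge0 ?exprn_ge0 ?sqn_ge0.
rewrite exprMn.
apply: (@le_trans _ _ (sqn u * sqn (M ^+ q *m (M ^+ q *m u)) * (sqn u ^+ q.-1) ^+ 2)).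
  by rewrite ler_wpM2r ?exprn_ge0 ?sqn_ge0 ?sqn_mulmx_sym.
rewrite mulmxA mulmxE -expr2 -mulrA mulrCA -!exprM -exprS.
by rewrite (_ : (q * 2).-1 = (q.-1 * 2).+1)%N //; lia.
Qed.

Lemma trace_power_sqr (F : realFieldType) n (M : 'M[F]_n) q : M^T = M ->
  \tr (M ^+ (2 * q)) = \sum_j \sum_l (M ^+ q) j l ^+ 2.
Proof.
move=> sM; rewrite mulnC exprM expr2 -mulmxE.
have sMq : (M ^+ q)^T = M ^+ q by rewrite trmx_exp sM.
apply: eq_bigr => j _; rewrite mxE; apply: eq_bigr => l _.
by rewrite -{2}sMq mxE expr2.
Qed.

(** With [q = 2 ^ p], the trace is the squared Frobenius norm of [M ^+ q] and so controls
    [|M^q u|^2]. Inserting this into [sqn_mulmx_power] and taking [q]-th roots gives the bound. *)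
Lemma trace_opnorm (F : realFieldType) n (M : 'M[F]_n) p d u : M^T = M -> 0 <= d ->
  \tr (M ^+ (2 * 2 ^ p)) <= d ^+ (2 ^ p) -> sqn (M *m u) <= d * sqn u.
Proof.
move=> sM d0 htr; have := sqn_mulmx_power u p sM.
have q0 : (0 < 2 ^ p)%N by rewrite expn_gt0.
move: htr q0; set q := (2 ^ p)%N => htr q0 h.
rewrite -(ler_pXn2r q0) ?nnegrE ?mulr_ge0 ?sqn_ge0 // (le_trans h) //.
rewrite exprMn -(prednK q0) /= [sqn u ^+ q.-1.+1]exprS mulrA.
rewrite ler_wpM2r ?exprn_ge0 ?sqn_ge0 // prednK //.
apply: le_trans (sqn_mulmx_frob _ _) _.
by rewrite ler_wpM2r ?sqn_ge0 // -trace_power_sqr.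
Qed.

(** * Dual certificates and recovery from small off-diagonal Gram matrices *)

(* The condition on [v j * x j ord0] forces [x] to vanish outside [S]. *)
Lemma l1_recovers_dual N (A : 'M[R]_N) (Om S : {set 'I_N}) (x : 'cV[R]_N) (v w : 'I_N -> R) :
  (forall j, v j = \sum_(i in Om) w i * A i j) ->
  (forall j, v j * x j ord0 = `|x j ord0|) ->
  (forall j, j \in S -> `|v j| <= 1) -> (forall j, j \notin S -> `|v j| < 1) ->
  (forall h : 'cV[R]_N, (forall j, j \notin S -> h j ord0 = 0) ->
     (forall i, i \in Om -> (A *m h) i ord0 = 0) -> h = 0) ->
  l1_recovers A Om x.
Proof.
move=> vE vx vS vC inj z Az zx.
have v1 j : `|v j| <= 1 by have [/vS//|/vC/ltW] := boolP (j \in S).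
have nz (a c : R) : `|a| < 1 -> a * c = `|c| -> c = 0.
  move=> lt e; apply/eqP; rewrite -normr_eq0; apply/eqP.
  have := congr1 (@Num.norm _ _) e; rewrite normrM normr_id.
  have := normr_ge0 c; move: lt; nra.
have xS j : j \notin S -> x j ord0 = 0 by move=> /vC lt; apply: nz lt (vx j).
have dot0 : \sum_j v j * (z j ord0 - x j ord0) = 0.
  under eq_bigr do rewrite vE big_distrl /=.
  rewrite exchange_big big1 //= => i iO.
  under eq_bigr do rewrite -mulrA mulrBr.
  rewrite -big_distrr /= sumrB; have := Az i iO; rewrite !mxE => ->.
  by rewrite subrr mulr0.
have l1x : l1norm x = \sum_j v j * z j ord0.
  apply/eqP; rewrite eq_sym -subr_eq0; apply/eqP; apply: etrans dot0; rewrite /l1norm -sumrB.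
  by apply: eq_bigr => j _; rewrite mulrBr vx.
have pos j : 0 <= `|z j ord0| - v j * z j ord0.
  rewrite subr_ge0 (le_trans (ler_norm _)) // normrM.
  by rewrite -[X in _ <= X]mul1r ler_wpM2r.
rewrite l1x -subr_gt0 /l1norm -sumrB lt_def sumr_ge0 // andbT.
(* Equal norms would make every term [|z_j| - v_j z_j] zero. Off [S], where [|v_j| < 1], this forces
   [z_j = 0], so [z - x] is a kernel vector supported in [S]. *)
apply/eqP => /psumr_eq0P h; apply: zx; apply/eqP; rewrite -subr_eq0; apply/eqP; apply: inj.
  move=> j jS; rewrite !mxE xS // subr0; apply: nz (vC j jS) _.
  by apply/esym/eqP; rewrite -subr_eq0 h.
move=> i iO; rewrite mulmxBr !mxE; have := Az i iO; rewrite !mxE => ->.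
exact: subrr.
Qed.

Lemma sqnB (F : realFieldType) n (u v : 'cV[F]_n) : sqn (u - v) <= 2 * sqn u + 2 * sqn v.
Proof.
rewrite /sqn !big_distrr /= -big_split /=; apply: ler_sum => j _.
rewrite !mxE; move: (u j ord0) (v j ord0) => a c; have := sqr_ge0 (a + c); lra.
Qed.

(** Write [u] as [(1 + H) u - H u] and absorb the second term. *)
Lemma sqn_neumann (F : realFieldType) n (H : 'M[F]_n) :
  (forall u, sqn (H *m u) <= 4^-1 * sqn u) ->
  forall u, sqn u <= 4 * sqn ((1%:M + H) *m u).
Proof.
move=> hH u; have := sqnB ((1%:M + H) *m u) (H *m u).
rewrite {1}mulmxDl mul1mx addrK; have := hH u; lra.
Qed.

Lemma neumann_unit (F : realFieldType) n (H : 'M[F]_n) : H^T = H ->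
  (forall u, sqn (H *m u) <= 4^-1 * sqn u) -> 1%:M + H \in unitmx.
Proof.
move=> sH hH; rewrite -row_free_unit; apply: inj_row_free => v vQ.
apply: trmx_inj; rewrite trmx0; apply: sqn_eq0; apply/eqP; rewrite eq_le sqn_ge0 andbT.
apply: le_trans (sqn_neumann hH _) _.
have -> : (1%:M + H) *m v^T = 0.
  by apply: trmx_inj; rewrite trmx_mul trmxK linearD /= trmx1 sH vQ trmx0.
by rewrite /sqn big1 ?mulr0 // => j _; rewrite mxE expr0n.
Qed.

Lemma offgram_sym N (Om T : {set 'I_N}) (A : 'M[R]_N) : (offgram Om T A)^T = offgram Om T A.
Proof.
apply/matrixP => j l; rewrite !mxE [l == j]eq_sym [X in if X then _ else _]andbCA.
by case: ifP => // _; apply: eq_bigr => i _; rewrite mulrC.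
Qed.

(** The vectors [W r] are built from [A] alone and are chosen before [sigma]; this lets a tail bound
    over the signs be applied with [A] fixed. *)
Lemma offgram_recovery N (Om S : {set 'I_N}) (A : 'M[R]_N) (a : 'I_N -> R) (d : R) :
  (0 < #|Om|)%N -> S != set0 -> (forall j, j \in S -> 0 < a j) ->
  (forall i j, A i j ^+ 2 = 1) -> d <= 4^-1 ->
  (forall r u, sqn ((#|Om|%:R^-1 *: offgram Om (r |: S) A) *m u) <= d * sqn u) ->
  exists2 W : 'I_N -> 'cV[R]_N, forall r, sqn (W r) <= 4 * d &
    forall sigma : {ffun 'I_N -> bool},
      (forall r, r \notin S -> `|\sum_(j in S) sgnb (sigma j) * W r j ord0| < 1) ->
      l1_recovers A Om (signed_vec S a sigma).
Proof.
move=> Om0 /set0Pn[r0 r0S] a0 A1 d4 hT; set n : R := #|Om|%:R in hT *.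
have n0 : n != 0 by rewrite pnatr_eq0 -lt0n.
pose H T : 'M[R]_N := n^-1 *: offgram Om T A.
(* For [r0] in [S] the set [r0 |: S] is [S] itself. *)
have hS u : sqn (H S *m u) <= 4^-1 * sqn u.
  have := hT r0 u; rewrite (setUidPr _) ?sub1set // => /le_trans; apply.
  by rewrite ler_wpM2r ?sqn_ge0.
have sH T : (H T)^T = H T by rewrite /H linearZ /= offgram_sym.
(* [H S] vanishes outside [S], so [Q] is the normalised Gram matrix of the columns in [S], completed
   by the identity. *)
pose Q : 'M[R]_N := 1%:M + H S.
have Qu : Q \in unitmx := neumann_unit (sH S) hS.
have Qn := sqn_neumann hS; rewrite -/Q in Qn.
pose G j l : R := n^-1 * \sum_(i in Om) A i j * A i l.
have Gd j : G j j = 1.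
  rewrite /G (eq_bigr (fun=> 1)) => [|i _]; last by rewrite -expr2.
  by rewrite sumr_const mulVf.
have QE (y : 'cV[R]_N) j : (forall l, l \notin S -> y l ord0 = 0) ->
    (Q *m y) j ord0 = if j \in S then \sum_l G j l * y l ord0 else y j ord0.
  move=> yS; rewrite mulmxDl mul1mx mxE [(H S *m y) _ _]mxE; case: ifP => jS; last first.
    by rewrite big1 ?addr0 // => l _; rewrite !mxE jS /= mulr0 mul0r.
  rewrite [RHS](bigD1 j) //= Gd mul1r (bigD1 j) //= !mxE eqxx !andbF mulr0 mul0r add0r.
  congr (_ + _); apply: eq_bigr => l lj; rewrite !mxE jS eq_sym lj andbT /=.
  by case: ifP => // /negbT/yS ->; rewrite !mulr0.
pose g (r : 'I_N) : 'cV[R]_N := H (r |: S) *m delta_mx r ord0.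
pose W r : 'cV[R]_N := invmx Q *m g r.
have gE r j : g r j ord0 = H (r |: S) j r.
  rewrite mxE (bigD1 r) //= [delta_mx _ _ _ _]mxE !eqxx mulr1 big1 ?addr0 // => l lr.
  by rewrite [delta_mx _ _ _ _]mxE (negbTE lr) mulr0.
exists W => [r|sigma hW].
  apply: le_trans (Qn _) _; rewrite /W mulKVmx // ler_wpM2l //.
  apply: le_trans (hT r _) _.
  rewrite [sqn _](_ : _ = 1) ?mulr1 // /sqn (bigD1 r) //= mxE !eqxx expr1n big1 ?addr0 //.
  by move=> l lr; rewrite mxE (negbTE lr) expr0n.
pose sg : 'cV[R]_N := \col_j if j \in S then sgnb (sigma j) else 0.
pose y : 'cV[R]_N := invmx Q *m sg.
have Qy : Q *m y = sg by rewrite /y mulKVmx.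
have yS l : l \notin S -> y l ord0 = 0.
  move=> lS; have := congr1 (fun M : 'cV[R]_N => M l ord0) Qy.
  rewrite mulmxDl mul1mx mxE [(H S *m y) _ _]mxE [sg _ _]mxE (negbTE lS).
  rewrite big1 ?addr0 // => i _.
  by rewrite !mxE (negbTE lS) /= mulr0 mul0r.
pose v j : R := \sum_l G j l * y l ord0.
have vS j : j \in S -> v j = sgnb (sigma j).
  move=> jS; have := congr1 (fun M : 'cV[R]_N => M j ord0) Qy.
  by rewrite (QE _ _ yS) jS mxE jS.
have sgn1 e : `|sgnb e| = 1 by case: e; rewrite /sgnb ?normrN normr1.
have vC r : r \notin S -> v r = \sum_(j in S) sgnb (sigma j) * W r j ord0.
  move=> rS; have -> : v r = (y^T *m g r) ord0 ord0.
    rewrite mxE; apply: eq_bigr => l _; rewrite gE [y^T _ _]mxE.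
    have [lS|/yS ->] := boolP (l \in S); last by rewrite mulr0 mul0r.
    have lr : l != r by apply: contraNneq rS => <-.
    rewrite [H _ _ _]mxE [offgram _ _ _ _ _]mxE !inE lS eqxx lr orbT /= mulrC /G.
    congr (_ * (_ * _)).
    by apply: eq_bigr => i _; rewrite mulrC.
  (* Symmetry of [Q] moves its inverse from the sign vector to [g r], isolating the dependence on
     [sigma]. *)
  have -> : y^T *m g r = sg^T *m W r.
    rewrite /W /y trmx_mul trmx_inv linearD /= trmx1 sH.
    by rewrite !mulmxA.
  rewrite mxE [RHS]big_mkcond; apply: eq_bigr => j _; rewrite [sg^T _ _]mxE [sg _ _]mxE.
  by case: ifP => //; rewrite mul0r.
apply: (l1_recovers_dual (S := S) (v := v) (w := fun i => n^-1 * \sum_l A i l * y l ord0)).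
- move=> j; rewrite /v /G.
  under eq_bigr do rewrite -mulrA big_distrl big_distrr /=.
  under [RHS]eq_bigr do rewrite -mulrA big_distrl big_distrr /=.
  rewrite exchange_big; apply: eq_bigr => i _; apply: eq_bigr => l _; ring.
- move=> j; rewrite mxE; case: ifP => jS; last by rewrite mulr0 normr0.
  by rewrite vS // mulrA sgnb_sqr mul1r normrM sgn1 mul1r gtr0_norm ?a0.
- by move=> j jS; rewrite vS // sgn1.
- by move=> r rS; rewrite vC // hW.
(* On vectors supported in [S], the matrix [Q] factors through the rows of [A] in [Om], so
   [Q *m h = 0]. *)
move=> h hS0 Ah; apply: sqn_eq0; apply/eqP; rewrite eq_le sqn_ge0 andbT.
apply: le_trans (Qn _) _; rewrite (_ : Q *m h = 0).
  by rewrite /sqn big1 ?mulr0 // => j _; rewrite mxE expr0n.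
apply/matrixP => j k; rewrite (ord1 k) (QE _ _ hS0) mxE; case: ifP => jS; last by rewrite hS0 ?jS.
rewrite /G; under eq_bigr do rewrite -mulrA big_distrl /=.
rewrite -big_distrr exchange_big /= big1 ?mulr0 // => i iO.
under eq_bigr do rewrite -mulrA.
by rewrite -big_distrr /=; have := Ah i iO; rewrite mxE => ->; rewrite mulr0.
Qed.

(** * Hoeffding's inequality as a count of sign patterns *)

(** For [x^2 <= 1/2], the bound [e^y <= 1/(1-y)] at [x] and [-x] sums to [2/(1-x^2) <= 2(1+2x^2)].
    For larger [x], both [x] and [-x] are at most [2x^2]. *)
Lemma cosh_le_expR (F : realType) (x : F) : expR x + expR (- x) <= 2 * expR (2 * x ^+ 2).
Proof.
have [x2|x2] := leP (x ^+ 2) 2^-1; last first.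
  have h y : y ^+ 2 = x ^+ 2 -> expR y <= expR (2 * x ^+ 2).
    by move=> e; rewrite ler_expR; move: x2; rewrite -e; nra.
  by rewrite mulr_natl mulr2n lerD // h // sqrrN.
have x1 : 0 < 1 - x by nra.
have x1' : 0 < 1 + x by nra.
have inv y : 0 < 1 - y -> expR y <= (1 - y)^-1.
  move=> y1; rewrite -[y in expR y]opprK expRN lef_pV2 ?posrE ?expR_gt0 //.
  exact: expR_ge1Dx.
apply: (@le_trans _ _ ((1 - x)^-1 + (1 + x)^-1)).
  by rewrite lerD ?inv // -[X in (1 + X)^-1]opprK inv // opprK.
have -> : (1 - x)^-1 + (1 + x)^-1 = 2 / (1 - x ^+ 2).
  by field; rewrite !lt0r_neq0 //; nra.
rewrite ler_wpM2l // (le_trans _ (expR_ge1Dx _)) //.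
rewrite -[X in X <= _]mul1r ler_pdivrMr; last by lra.
by have := sqr_ge0 x; nra.
Qed.

Lemma card_markov (F : numDomainType) (T : finType) (f : T -> F) (P : pred T) (c : F) :
  (forall t, 0 <= f t) -> (forall t, P t -> c <= f t) -> c * #|P|%:R <= \sum_t f t.
Proof.
move=> f0 fc; rewrite (bigID P) /= -[X in X <= _]addr0 lerD ?sumr_ge0 //.
by rewrite mulr_natr -sumr_const; apply: ler_sum.
Qed.

Lemma sum_expR_signs (I : finType) (c : I -> R) :
  \sum_(s : {ffun I -> bool}) expR (\sum_i sgnb (s i) * c i) <=
  2 ^+ #|I| * expR (2 * \sum_i c i ^+ 2).
Proof.
under eq_bigr do rewrite expR_sum.
rewrite -(bigA_distr_bigA (fun i e => expR (sgnb e * c i))) /=.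
rewrite big_distrr expR_sum /= -prodr_const -big_split /=.
apply: ler_prod => i _; rewrite big_bool /= mul1r mulN1r addr_ge0 ?expR_ge0 //=.
exact: cosh_le_expR.
Qed.

Lemma card_signs_ge1 (I : finType) (c : I -> R) (v : R) : 0 < v -> \sum_i c i ^+ 2 <= v ->
  #|[pred s : {ffun I -> bool} | 1 <= \sum_i sgnb (s i) * c i]|%:R
    <= 2 ^+ #|I| * expR (- (8 * v)^-1).
Proof.
(* [l = 1/(4v)] minimises the Chernoff exponent [2 l^2 v - l], whose value there is [-1/(8v)]. *)
move=> v0 cv; pose l := (4 * v)^-1.
have l0 : 0 < l by rewrite invr_gt0 mulr_gt0.
have h := sum_expR_signs (fun i => l * c i).
have el : l = (8 * v)^-1 + 2 * l ^+ 2 * v by rewrite /l; field; rewrite lt0r_neq0.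
suff : expR l * #|[pred s : {ffun I -> bool} | 1 <= \sum_i sgnb (s i) * c i]|%:R
     <= 2 ^+ #|I| * expR (2 * l ^+ 2 * v).
  rewrite mulrC -ler_pdivlMr ?expR_gt0 // => /le_trans; apply.
  rewrite -[X in X <= _]mulrA -expRB.
  by rewrite ler_wpM2l ?exprn_ge0 // ler_expR {2}el; lra.
pose f (s : {ffun I -> bool}) := expR (\sum_i sgnb (s i) * (l * c i)).
apply: le_trans (card_markov (f := f) _ _) _.
- by move=> s; apply: expR_ge0.
- move=> s /=; rewrite /f ler_expR => h1; under eq_bigr do rewrite mulrCA.
  by rewrite -big_distrr /= ler_peMr // ltW.
apply: le_trans h _; rewrite ler_wpM2l ?exprn_ge0 // ler_expR -mulrA ler_wpM2l //.
under eq_bigr do rewrite exprMn.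
by rewrite -big_distrr ler_wpM2l // sqr_ge0.
Qed.

Lemma card_signs_norm_ge1 (I : finType) (c : I -> R) (v : R) : 0 < v ->
  \sum_i c i ^+ 2 <= v ->
  #|[pred s : {ffun I -> bool} | 1 <= `|\sum_i sgnb (s i) * c i|]|%:R
    <= 2 ^+ #|I| * (2 * expR (- (8 * v)^-1)).
Proof.
move=> v0 cv; have h1 := card_signs_ge1 v0 cv.
have cv' : \sum_i (- c i) ^+ 2 <= v by under eq_bigr do rewrite sqrrN.
have h2 := card_signs_ge1 v0 cv'.
apply: (@le_trans _ _ (#|[pred s : {ffun I -> bool} | 1 <= \sum_i sgnb (s i) * c i]|%:R +
   #|[pred s : {ffun I -> bool} | 1 <= \sum_i sgnb (s i) * - c i]|%:R)); last by lra.
rewrite -natrD ler_nat -cardUI (leq_trans _ (leq_addr _ _)) //.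
apply/subset_leq_card/subsetP => s; rewrite !inE.
under [X in _ -> _ || (1 <= X)]eq_bigr do rewrite mulrN.
by rewrite sumrN ler_normr.
Qed.

(** * Union bounds and the probability of recovery *)

Lemma unif_prob_ge (T : finType) (E : T -> Prop) (eps : R) : (0 < #|T|)%N ->
  #|[set t | `[< ~ E t >]]|%:R <= eps * #|T|%:R -> 1 - eps <= unif_prob E.
Proof.
move=> T0 h; have T0' : 0 < #|T|%:R :> R by rewrite ltr0n.
rewrite /unif_prob ler_pdivlMr // mulrBl mul1r lerBlDr -lerBlDl.
apply: le_trans h; rewrite lerBlDl -natrD ler_nat -(cardsC [set t | `[< E t >]]) leq_add2l.
apply/subset_leq_card/subsetP => t; rewrite !inE => /asboolPn h.
exact/asboolP.
Qed.

(** Supplies the moment order, which [trace_opnorm] requires to be a power of two. *)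
Lemma pow2_between (F : archiRealFieldType) (x : F) : 1 <= x ->
  exists p, x <= (2 ^ p)%:R <= 2 * x.
Proof.
move=> x1; have ex : exists p, x <= (2 ^ p)%:R.
  exists (Num.bound x); apply: ltW; apply: lt_trans (archi_boundP _) _; first by lra.
  by rewrite ltr_nat ltn_expl.
case: (ex_minnP ex) => -[|p] hp hmin; [exists 0%N|exists p.+1]; rewrite hp /=.
  by rewrite expn0; lra.
have : ~~ (x <= (2 ^ p)%:R) by apply/negP => /hmin; rewrite ltnn.
by rewrite -ltNge expnS natrM; lra.
Qed.

Lemma scalemx_exp (F : comPzRingType) n (c : F) (M : 'M[F]_n) k :
  (c *: M) ^+ k = c ^+ k *: M ^+ k.
Proof.
elim: k => [|k IH]; first by rewrite !expr0 scale1r.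
by rewrite !exprS IH -!mulmxE -scalemxAl -scalemxAr scalerA.
Qed.

Lemma card_large_trace N (K : finType) (V : zmodType) (iota : 'I_N -> V)
    (phi : 'I_N -> 'I_N -> K) (Om T : {set 'I_N}) m (d : R) :
  injective iota ->
  (forall i j i' j', phi i j = phi i' j' -> iota j - iota i = iota j' - iota i') ->
  (0 < m)%N -> (0 < #|Om|)%N -> (#|T| <= #|Om|)%N -> 0 < d ->
  1024 * m%:R ^+ 2 * #|T|%:R <= #|Om|%:R * d ->
  #|[pred b : {ffun K -> bool} |
      d ^+ m < \tr ((#|Om|%:R^-1 *: offgram Om T (sgnmx phi b)) ^+ (2 * m))]|%:R
    <= 2 ^+ #|K| * (#|T|%:R * 4^-1 ^+ m) :> R.
Proof.
move=> iinj hphi m0 O0 TO d0 hd.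
set n : R := #|Om|%:R in hd *; set t : R := #|T|%:R in hd *.
have n0 : 0 < n by rewrite ltr0n.
pose B (b : {ffun K -> bool}) := offgram Om T (sgnmx phi b).
have sB b : (n^-1 *: B b)^T = n^-1 *: B b by rewrite linearZ /= offgram_sym.
have h := sum_trace_offgram iinj hphi m0 TO.
have mk := @card_markov R _ (fun b => \tr ((n^-1 *: B b) ^+ (2 * m)))
  [pred b : {ffun K -> bool} | d ^+ m < \tr ((n^-1 *: B b) ^+ (2 * m))] (d ^+ m).
rewrite -(ler_pM2l (exprn_gt0 m d0)); apply: le_trans (mk _ _) _.
- move=> b; rewrite trace_power_sqr //.
  by do 2! apply: sumr_ge0 => ? _; apply: sqr_ge0.
- by move=> b /= /ltW.
under eq_bigr do rewrite scalemx_exp linearZ /=.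
rewrite -big_distrr /=; apply: (@le_trans _ _ (n^-1 ^+ (2 * m) *
   (2 ^ #|K| * ((2 ^ (4 * m) * (4 * m) ^ (2 * m)) * (#|T| ^ m.+1 * #|Om| ^ m)))%:R)).
  by rewrite ler_wpM2l // exprn_ge0 // invr_ge0 ltW.
rewrite !natrM !natrX -/n -/t natrM.
(* Here [256 = 2^4 * 4^2] comes from the count of pairings. The hypothesis, with [1024 = 4 * 256],
   bounds the base by [d / 4], and the spare [4] yields the factor [4^-m]. *)
have -> : n^-1 ^+ (2 * m) *
    (2 ^+ #|K| * (2 ^+ (4 * m) * (4 * m%:R) ^+ (2 * m) * (t ^+ m.+1 * n ^+ m)))
  = (2 ^+ #|K| * t) * (256 * m%:R ^+ 2 * t / n) ^+ m.
  have e : n^-1 ^+ (2 * m) * n ^+ m = n^-1 ^+ m.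
    by rewrite mul2n -addnn exprD -mulrA -exprMn mulVf ?lt0r_neq0 // expr1n mulr1.
  have e2 : 2 ^+ (4 * m) * (4 * m%:R) ^+ (2 * m) * t ^+ m = (256 * m%:R ^+ 2 * t) ^+ m :> R.
    rewrite !(exprM _ _ m) -!exprMn; congr (_ ^+ _); ring.
  rewrite [X in _ = _ * X]exprMn -e -e2 exprS; ring.
have -> : d ^+ m * (2 ^+ #|K| * (t * 4^-1 ^+ m)) = (2 ^+ #|K| * t) * (d / 4) ^+ m.
  by rewrite exprMn; ring.
rewrite ler_wpM2l ?mulr_ge0 ?exprn_ge0 //.
have [n0' d0'] := (ltW n0, ltW d0).
rewrite ler_pXn2r ?nnegrE ?divr_ge0 ?mulr_ge0 ?exprn_ge0 //.
by rewrite ler_pdivrMr //; lra.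
Qed.

Lemma card_set_sum (U : finType) (Q : pred U) : #|[set u | Q u]| = (\sum_u Q u)%N.
Proof. by rewrite -sum1_card big_mkcond; apply: eq_bigr => u _; rewrite inE; case: (Q u). Qed.

Lemma card_pairs_sum (S T : finType) (P : S -> T -> bool) :
  #|[set p : S * T | P p.1 p.2]| = (\sum_(t : T) #|[set s | P s t]|)%N.
Proof.
rewrite card_set_sum -(pair_bigA _ (fun s t => nat_of_bool (P s t))) exchange_big /=.
by apply: eq_bigr => t _; rewrite card_set_sum.
Qed.

Lemma card_exists_le (I T : finType) (P : I -> pred T) :
  (#|[set t | [exists r, P r t]]| <= \sum_r #|P r|)%N.
Proof.
rewrite card_set_sum; under [X in (_ <= X)%N]eq_bigr do rewrite -cardsE card_set_sum.
rewrite exchange_big; apply: leq_sum => t _; case: existsP => //= -[r Pr].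
by rewrite (bigD1 r) //= (_ : t \in P r).
Qed.

Lemma expR_half_le2 : expR 2^-1 <= 2 :> R.
Proof.
have : 2^-1 <= expR (- 2^-1) :> R by apply: le_trans (expR_ge1Dx _); lra.
have := expR_gt0 (2^-1 : R); have := expRxMexpNx_1 (2^-1 : R); nra.
Qed.

Lemma expR1_le4 : expR 1 <= 4 :> R.
Proof.
rewrite (_ : 1 = 2^-1 + 2^-1 :> R) ?expRD; last by lra.
have := expR_half_le2; have := expR_gt0 (2^-1 : R); nra.
Qed.

Lemma ln_ratio_ge (N : nat) (eps : R) : (2 <= N)%N -> 0 < eps -> eps < 1 ->
  2^-1 <= ln (N%:R / eps).
Proof.
move=> N2 e0 e1; have N2' : 2 <= N%:R :> R by rewrite ler_nat.
rewrite -ler_expR lnK ?posrE ?divr_gt0 ?ltr0n //; last by lia.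
by rewrite ler_pdivlMr //; have := expR_half_le2; have := expR_gt0 (2^-1 : R); nra.
Qed.

Lemma expR_ln_ratio (N : nat) (eps : R) : (0 < N)%N -> 0 < eps ->
  expR (- (3 * ln (N%:R / eps))) = (eps / N%:R) ^+ 3.
Proof.
move=> N0 e0.
by rewrite -mulrN expRM_natl expRN lnK ?posrE ?divr_gt0 ?ltr0n // invf_div.
Qed.

(** With [q = (eps/N)^3 = exp(-3L)], the matrices having some large [H_T] form a fraction at most
    [N^2 q]. For every other matrix, the signs that fail form a fraction at most [2 N q]. *)
Lemma recovery_probability N (K : finType) (V : zmodType) (iota : 'I_N -> V)
    (phi : 'I_N -> 'I_N -> K) (Om S : {set 'I_N}) (s : nat) (a : 'I_N -> R) (eps : R) :
  injective iota ->
  (forall i j i' j', phi i j = phi i' j' -> iota j - iota i = iota j' - iota i') ->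
  (2 <= N)%N -> 0 < eps -> eps < 1 -> (#|S| <= s)%N -> (forall j, j \in S -> 0 < a j) ->
  1024 * 72 * 96 * s%:R * ln (N%:R / eps) ^+ 3 <= #|Om|%:R ->
  1 - eps <= unif_prob (fun p : {ffun 'I_N -> bool} * {ffun K -> bool} =>
    l1_recovers (sgnmx phi p.2) Om (signed_vec S a p.1)).
Proof.
move=> iinj hphi N2 e0 e1 Ss a0 hn.
have T0 : (0 < #|{: {ffun 'I_N -> bool} * {ffun K -> bool}}|)%N.
  by rewrite card_prod !card_ffun card_bool muln_gt0 !expn_gt0.
apply: unif_prob_ge => //.
(* For empty [S] the signal is [0] and the zero certificate always works. *)
have [S0|Sn0] := eqVneq S set0.
  rewrite (_ : [set _ | _] = set0); first by rewrite cards0 mulr_ge0 // ltW.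
  apply/setP => p; rewrite !inE; apply/negbTE/asboolPn; rewrite notE.
  apply: (l1_recovers_dual (S := set0) (v := fun=> 0) (w := fun=> 0)) => [j|j|j|j|h hj _].
  - by rewrite big1 // => i _; rewrite mul0r.
  - by rewrite mxE S0 inE mul0r normr0.
  - by rewrite inE.
  - by rewrite normr0.
  - by apply/matrixP => j l; rewrite ord1 hj ?inE // mxE.
have s1 : 1 <= s%:R :> R.
  by rewrite ler1n (leq_trans _ Ss) // card_gt0.
have L2 := ln_ratio_ge N2 e0 e1.
have N0 : (0 < N)%N by lia.
have expL := expR_ln_ratio N0 e0.
set L := ln _ in L2 expL hn; set n : R := #|Om|%:R in hn.
have N2' : 2 <= N%:R :> R by rewrite ler_nat.
pose q := (eps / N%:R) ^+ 3.
have qN : N%:R ^+ 3 * q = eps ^+ 3.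
  by rewrite /q -exprMn mulrC divfK // lt0r_neq0 //; lra.
have q0 : 0 < q by rewrite exprn_gt0 // divr_gt0 //; lra.
have eps3 : eps ^+ 3 <= eps by rewrite exprSr ler_piMl ?exprn_ile1 // ltW.
have L3 : 4^-1 * L <= L ^+ 3.
  have := sqr_ge0 (L - 2^-1); rewrite exprS; nra.
have nL : 1024 * 72 * 96 * s%:R * L ^+ 2 * L <= n by move: hn; rewrite (exprSr _ 2) mulrA.
(* Since [L >= 1/2], the size condition also yields [|T| <= s + 1 <= 2s <= n], as the walk count
   requires. *)
have n2s : 2 * s%:R <= n.
  apply: le_trans hn; have : 8^-1 <= L ^+ 3 by lra.
  by nra.
have Om0 : (0 < #|Om|)%N by rewrite -(ltr0n R) -/n; lra.
(* The lower bound on [m] makes [4^-m <= exp(-m) <= q]; the upper bound [6L] limits the number of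
   rows needed. *)
have [p /andP[mlo mhi]] : exists p, 3 * L <= (2 ^ p)%:R <= 2 * (3 * L).
  by apply: pow2_between; lra.
set m := (2 ^ p)%N in mlo mhi.
have m0 : (0 < m)%N by rewrite expn_gt0.
(* [d] bounds the squared norms of the [H_T]; the factor 96 makes [(8 * (4 * d))^-1 = 3 * L]. *)
pose d : R := (96 * L)^-1.
have L0 : 0 < L by lra.
have d0 : 0 < d by rewrite invr_gt0 mulr_gt0.
have d4 : d <= 4^-1 by rewrite lef_pV2 ?posrE ?mulr_gt0 //; lra.
have cT r : (#|r |: S| <= s.+1)%N by rewrite cardsU1 (leq_trans (leq_add (leq_b1 _) Ss)).
have cTR r : #|r |: S|%:R <= 2 * s%:R :> R.
  apply: (@le_trans _ _ s.+1%:R); first by rewrite ler_nat.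
  by rewrite -addn1 natrD; lra.
have cTN r : #|r |: S|%:R <= N%:R :> R by rewrite ler_nat (leq_trans (max_card _)) ?card_ord.
have q4 : 4^-1 ^+ m <= q.
  rewrite /q -expL; apply: (@le_trans _ _ (expR (- m%:R))); last by rewrite ler_expR lerN2.
  rewrite exprVn expRN lef_pV2 ?posrE ?expR_gt0 ?exprn_gt0 //.
  rewrite -[m%:R]mulr1 expRM_natl ler_pXn2r ?nnegrE ?expR_ge0 //; exact: expR1_le4.
pose bad r := [pred b : {ffun K -> bool} |
   d ^+ m < \tr ((n^-1 *: offgram Om (r |: S) (sgnmx phi b)) ^+ (2 * m))].
have cbad r : #|bad r|%:R <= 2 ^+ #|K| * (N%:R * q) :> R.
  apply: le_trans (card_large_trace iinj hphi m0 Om0 _ d0 _) _.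
  - by rewrite -(ler_nat R); apply: le_trans n2s.
  (* Origin of the constant: [m^2 <= 36 L^2] and [|T| <= 2s] give [72], while [d] contributes
     [96 L]. *)
  - rewrite -/n /d ler_pdivlMr ?mulr_gt0 //.
    have m2 : m%:R ^+ 2 <= 36 * L ^+ 2.
      rewrite (_ : 36 * L ^+ 2 = (2 * (3 * L)) ^+ 2) ?ler_pXn2r ?nnegrE //; [lra|ring].
    have := cTR r; set t : R := #|_|%:R => tt.
    have t0 : 0 <= t by [].
    have mt : m%:R ^+ 2 * t <= 36 * L ^+ 2 * (2 * s%:R) by rewrite ler_pM // sqr_ge0.
    have : m%:R ^+ 2 * t * L <= 36 * L ^+ 2 * (2 * s%:R) * L by rewrite ler_wpM2r // ltW.
    by lra.
  by rewrite ler_wpM2l ?exprn_ge0 // ler_pM ?exprn_ge0 ?invr_ge0 //.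
pose Bad := [set b | [exists r, bad r b]].
have cBad : #|Bad|%:R <= 2 ^+ #|K| * (N%:R ^+ 2 * q) :> R.
  apply: le_trans (_ : (\sum_r #|bad r|)%:R <= _); first by rewrite ler_nat card_exists_le.
  rewrite natr_sum; apply: (@le_trans _ _ (\sum_(r < N) 2 ^+ #|K| * (N%:R * q))).
    by apply: ler_sum => r _; apply: cbad.
  by rewrite sumr_const card_ord -[X in X <= _]mulr_natl expr2; lra.
pose E (sg : {ffun 'I_N -> bool}) (b : {ffun K -> bool}) :=
  `[< ~ l1_recovers (sgnmx phi b) Om (signed_vec S a sg) >].
(* For [b] in [Bad] all sign patterns are counted; otherwise a union bound over the [N] indices [r]
   applies. *)
have cE b : #|[set sg | E sg b]|%:R <= 2 ^+ N * ((b \in Bad)%:R + N%:R * (2 * q)) :> R.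
  have [bB|bB] := boolP (b \in Bad).
    apply: (@le_trans _ _ (2 ^+ N)).
      rewrite -natrX ler_nat (leq_trans (max_card _)) //.
      by rewrite card_ffun card_bool card_ord.
    have q0' := ltW q0; rewrite ler_peMr ?exprn_ge0 // lerDl; apply: mulr_ge0 => //.
    exact: mulr_ge0.
  have opn r u : sqn ((n^-1 *: offgram Om (r |: S) (sgnmx phi b)) *m u) <= d * sqn u.
    apply: (@trace_opnorm _ _ _ p); [by rewrite linearZ /= offgram_sym|exact: ltW|].
    rewrite leNgt; apply: contraNN bB => hb; rewrite inE; apply/existsP.
    by exists r.
  have A1 i j : sgnmx phi b i j ^+ 2 = 1 by rewrite mxE expr2 sgnb_sqr.
  have [W Wd Wrec] := offgram_recovery Om0 Sn0 a0 A1 d4 opn.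
  pose c r j := if j \in S then W r j ord0 else 0.
  have cW r : \sum_j c r j ^+ 2 <= 4 * d.
    apply: le_trans (Wd r); apply: ler_sum => j _; rewrite /c; case: ifP => // _.
    by rewrite expr0n sqr_ge0.
  have d40 : 0 < 4 * d by rewrite mulr_gt0.
  pose F r := [pred sg : {ffun 'I_N -> bool} | 1 <= `|\sum_j sgnb (sg j) * c r j|].
  have cF r : #|F r|%:R <= 2 ^+ N * (2 * q) :> R.
    have := card_signs_norm_ge1 d40 (cW r); rewrite card_ord.
    rewrite (_ : (8 * (4 * d))^-1 = 3 * L) ?expL //.
    by rewrite /d; field; rewrite lt0r_neq0.
  apply: (@le_trans _ _ (\sum_r #|F r|)%:R).
    rewrite ler_nat (leq_trans _ (card_exists_le F)) //.
    apply/subset_leq_card/subsetP => sg; rewrite !inE => /asboolP nE.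
    have [//|/existsPn nF] := boolP [exists r, F r sg]; case: nE; apply: Wrec => r rS.
    have := nF r; rewrite inE -ltNge (bigID (mem S)) /= [X in _ + X]big1 ?addr0.
      by rewrite (eq_bigr (fun j => sgnb (sg j) * W r j ord0)) // => j jS; rewrite /c jS.
    by move=> j /negbTE jS; rewrite /c jS mulr0.
  rewrite natr_sum; apply: (@le_trans _ _ (\sum_(r < N) 2 ^+ N * (2 * q))).
    by apply: ler_sum => r _; apply: cF.
  by rewrite sumr_const card_ord -[X in X <= _]mulr_natl add0r; lra.
rewrite (card_pairs_sum E) natr_sum.
apply: (@le_trans _ _ (\sum_(b : {ffun K -> bool}) 2 ^+ N * ((b \in Bad)%:R + N%:R * (2 * q)))).
  by apply: ler_sum => b _; apply: cE.
rewrite -big_distrr big_split /= sumr_const card_prod !card_ffun card_bool card_ord.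
rewrite natrM !natrX [X in _ <= X]mulrCA ler_wpM2l ?exprn_ge0 //.
have -> : \sum_(b : {ffun K -> bool}) (b \in Bad)%:R = #|Bad|%:R :> R.
  by rewrite -natr_sum -card_set_sum; congr (_%:R); apply: eq_card => b; rewrite !inE.
rewrite -[X in _ + X]mulr_natl natrX.
have k0 : 0 < 2 ^+ #|K| :> R by rewrite exprn_gt0.
(* As [N >= 2], [N^2 q + 2 N q <= 2 N^2 q <= N^3 q = eps^3 <= eps]. *)
apply: (@le_trans _ _ (2 ^+ #|K| * (N%:R ^+ 2 * q + N%:R * (2 * q)))); first by lra.
rewrite [X in _ <= X]mulrC (ler_wpM2l (ltW k0)) //.
move: qN; rewrite (exprS _ 2) -mulrA => qN.
have A0 : 0 <= N%:R ^+ 2 * q by rewrite mulr_ge0 ?sqr_ge0 // ltW.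
have B0 : 0 <= N%:R * q by rewrite mulr_ge0 // ltW.
have AB : N%:R ^+ 2 * q = N%:R * (N%:R * q) by rewrite mulrA.
have hA : 2 * (N%:R ^+ 2 * q) <= N%:R * (N%:R ^+ 2 * q) by rewrite ler_wpM2r.
have hB : 2 * (N%:R * q) <= N%:R * (N%:R * q) by rewrite ler_wpM2r.
lra.
Qed.

(** * Circulant labels as differences modulo [N], Toeplitz labels as integer differences *)

(** The hypothesis [2 <= N] ensures that ['Z_N] really is the ring of integers modulo [N]. *)
Lemma circ_idx_sub N (i j i' j' : 'I_N) : (2 <= N)%N -> circ_idx i j = circ_idx i' j' ->
  (j%:R - i%:R : 'Z_N) = j'%:R - i'%:R.
Proof.
move=> N2 /(congr1 val) /= e.
have sub (k l : 'I_N) : (l%:R - k%:R : 'Z_N) = ((l + N - k) %% N)%:R.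
  rewrite Zp_nat_mod // natrB ?natrD ?pchar_Zp ?addr0 //.
  by have := ltn_ord k; lia.
by rewrite !sub e.
Qed.

Lemma toep_idx_sub N (i j i' j' : 'I_N) : toep_idx i j = toep_idx i' j' ->
  j%:Z - i%:Z = j'%:Z - i'%:Z.
Proof.
move=> /(congr1 val) /=.
have := ltn_ord i; have := ltn_ord i'; have := ltn_ord j; have := ltn_ord j'; lia.
Qed.

Theorem theorem1 :
  exists C : R, 0 < C /\
  forall (N : nat) (eps : R) (Omega : {set 'I_N}) (s : nat)
         (Sx : {set 'I_N}) (a : 'I_N -> R),
    (2 <= N)%nat -> 0 < eps -> eps < 1 -> (#|Omega| < N)%nat ->
    (#|Sx| <= s)%nat -> (forall j, j \in Sx -> 0 < a j) ->
    #|Omega|%:R >= C * s%:R * (ln (N%:R / eps)) ^+ 3 ->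
    (1 - eps <=
       unif_prob (fun p : {ffun 'I_N -> bool} * {ffun 'I_N -> bool} =>
         l1_recovers (circulant (fun k => sgnb (p.2 k))) Omega
                     (signed_vec Sx a p.1)))
    /\
    (1 - eps <=
       unif_prob (fun p : {ffun 'I_N -> bool} * {ffun 'I_(2 * N - 1)%nat -> bool} =>
         l1_recovers (toeplitz (fun k => sgnb (p.2 k))) Omega
                     (signed_vec Sx a p.1))).
Proof.
exists (1024 * 72 * 96); split=> [|N eps Om s S a N2 e0 e1 _ Ss a0 hn].
  by rewrite !mulr_gt0.
split.
  apply: (recovery_probability (s := s) (iota := fun j : 'I_N => j%:R : 'Z_N)
    (phi := @circ_idx N)) => //.
    move=> j j' /(congr1 val) /=; rewrite !val_Zp_nat // !modn_small //; exact: val_inj.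
  by move=> i j i' j'; apply: circ_idx_sub.
apply: (recovery_probability (s := s) (iota := fun j : 'I_N => j%:Z)
  (phi := @toep_idx N)) => //.
  by move=> j j' [] /val_inj.
exact: toep_idx_sub.
Qed.
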